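(* In the setting and with the choices described in the context, let $\widetilde{N}_1=\mathfrak{s}(G,H,\mu)\cdot m\oplus X_m\oplus N_1$ be a symplectic slice at $m$ relative to the $H$-action, where $X_m=\mathfrak b\cdot m\oplus Y_m$ with $Y_m\subset N_0$ isomorphic to $\mathfrak b^*$. With respect to this splitting, the symplectic form $\omega_{\widetilde N_1}=\omega(m)|_{\widetilde N_1}$ reads $\Psi(m)\oplus\omega_{X_m}\oplus\omega_{N_1}$, where $\Psi(m)$ denotes the form $(x_M(m),x'_M(m))\mapsto\omega(m)(x_M(m),x'_M(m))=\langle\mu,[x,x']\rangle$ on $\mathfrak s(G,H,\mu)\cdot m$ (for $x,x'\in\mathfrak s(G,H,\mu)$), $\omega_{N_1}=\omega(m)|_{N_1}$, and $$\omega_{X_m}\left(b_M(m)+w,\;b'_M(m)+w'\right)=\langle f(w'),b\rangle-\langle f(w),b'\rangle$$ for every $b,b'\in\mathfrak b$ and $w,w'\in Y_m$, with $f:N_0\to\mathfrak m^*$ the isomorphism defined in the context.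
   Context: Setting. $(M,\omega)$ is a symplectic manifold with a smooth proper action of a Lie group $G$ preserving $\omega$; for $x$ in the Lie algebra $\mathfrak g$ of $G$, $x_M$ denotes the vector field $x_M(p)=\frac{d}{dt}|_{t=0}\exp(tx)\cdot p$. There is a momentum map $\Phi_G:M\to\mathfrak g^*$, $\iota_{x_M}\omega=d\langle\Phi_G(\cdot),x\rangle$ for all $x\in\mathfrak g$, equivariant for the coadjoint action of $G$ on $\mathfrak g^*$ given by $\langle \mathrm{Ad}^*_{g^{-1}}\lambda,x\rangle=\langle\lambda,\mathrm{Ad}_{g^{-1}}x\rangle$. Write $\langle\mathrm{ad}^*_x\lambda,y\rangle=\langle\lambda,[x,y]\rangle$. $H\subset G$ is a Lie subgroup with Lie algebra $\mathfrak h$; the induced momentum map is $\Phi_H:M\to\mathfrak h^*$, $\Phi_H(p)=\Phi_G(p)|_{\mathfrak h}$. Fix $m\in M$, $\mu=\Phi_G(m)$, $\alpha=\Phi_H(m)=\mu|_{\mathfrak h}$. $G_m,H_m$ are the stabilizers of $m$ in $G$ and $H$, with Lie algebras $\mathfrak g_m,\mathfrak h_m$; $\mathfrak g_\mu=\{x\in\mathfrak g:\mathrm{ad}^*_x\mu=0\}$, $\mathfrak h_\mu=\mathfrak h\cap\mathfrak g_\mu$, $\mathfrak h_\alpha=\{x\in\mathfrak h:\mathrm{ad}^*_x\alpha=0\text{ in }\mathfrak h^*\}$. For a subspace $\mathfrak k\subset\mathfrak g$, $\mathfrak k\cdot m=\{x_M(m):x\in\mathfrak k\}\subset T_mM$.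 Standing assumption (A): $G_m$ acts on $H$ by conjugation, i.e. $kHk^{-1}=H$ for all $k\in G_m$. Choices. $\mathfrak h^{\perp_\mu}:=\{x\in\mathfrak g: x_M(m)\in(\mathfrak h\cdot m)^{\omega(m)}\}$ ($^{\omega(m)}$ denotes the symplectic orthogonal in $T_mM$); it contains $\mathfrak g_\mu+\mathfrak h_\alpha$. Choose $G_m$-invariant subspaces as follows ($G_m$ is compact and acts by the adjoint action): $\mathfrak h_m^{\perp_{\mathfrak g_m}}$ a complement of $\mathfrak h_m$ in $\mathfrak g_m$; $\mathfrak p$ a complement of $\mathfrak h_m$ in $\mathfrak h_\mu$; $\mathfrak b$ a complement of $\mathfrak g_m+\mathfrak h_\mu$ in $\mathfrak g_\mu$ (so $\mathfrak g_\mu=\mathfrak h_m\oplus\mathfrak p\oplus\mathfrak h_m^{\perp_{\mathfrak g_m}}\oplus\mathfrak b$); $\mathfrak a$ a complement of $\mathfrak h_\mu$ in $\mathfrak h_\alpha$ (so $\mathfrak g_\mu+\mathfrak h_\alpha=\mathfrak g_\mu\oplus\mathfrak a$); $\mathfrak s(G,H,\mu)$ a complement of $\mathfrak g_\mu+\mathfrak h_\alpha$ in $\mathfrak h^{\perp_\mu}$; $\mathfrak q=\mathfrak a\oplus\mathfrak s(G,H,\mu)$; $(\mathfrak h^{\perp_\mu})^{\perp_{\mathfrak g}}$ a complement of $\mathfrak h^{\perp_\mu}$ in $\mathfrak g$. Set $\mathfrak m=\mathfrak p\oplus\mathfrak b$ and $\mathfrak n=\mathfrak q\oplus(\mathfrak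 h^{\perp_\mu})^{\perp_{\mathfrak g}}$, so that $\mathfrak g_\mu=\mathfrak g_m\oplus\mathfrak m$ and $\mathfrak g=\mathfrak g_m\oplus\mathfrak m\oplus\mathfrak n$. Witt–Artin decomposition relative to $G$: $T_mM=T_0\oplus T_1\oplus N_0\oplus N_1$ with $T_0=\mathfrak g_\mu\cdot m$; $T_1=\mathfrak n\cdot m$ (a symplectic subspace); $N_1$ a $G_m$-invariant complement to $T_0$ in $\ker(D\Phi_G(m))$ (a symplectic slice for $G$); $N_0$ a $G_m$-invariant Lagrangian complement to $T_0$ in $(T_1\oplus N_1)^{\omega(m)}$. The subspaces $T_1$, $N_1$ and $T_0\oplus N_0$ are mutually symplectically orthogonal. The map $f:N_0\to\mathfrak m^*$, $\langle f(w),y\rangle=\omega(m)(y_M(m),w)$ for $w\in N_0$, $y\in\mathfrak m$, is an isomorphism. A symplectic slice at $m$ relative to the $H$-action is an $H_m$-invariant complement to $\mathfrak h_\alpha\cdot m$ in $\ker(D\Phi_H(m))$, endowed with the restriction of $\omega(m)$. *)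

(* Defs.v *)
From HB Require Import structures.
From mathcomp Require Import all_boot all_order all_algebra.
From mathcomp Require Import all_classical all_reals all_analysis.

Set Implicit Arguments.
Unset Strict Implicit.
Unset Printing Implicit Defensive.

Import Order.TTheory GRing.Theory Num.Theory.
Import numFieldNormedType.Exports.

Local Open Scope classical_set_scope.
Local Open Scope ring_scope.

(* [Ck] and [smooth] are only used with E finite-dimensional and U open, where
   asking every x |-> 'd f x v to be of class C^k amounts to asking the
   derivative x |-> 'd f x to be so. *)
Fixpoint Ck (R : realType) (E F : normedModType R) (k : nat) (U : set E)
    (f : E -> F) : Prop :=
  match k with
  | 0%N => forall x, U x -> {for x, continuous f}
  | j.+1 => (forall x, U x -> differentiable f x)
            /\ forall v : E, Ck j U (fun x => 'd f x v)
  end.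

Definition smooth (R : realType) (E F : normedModType R) (U : set E)
    (f : E -> F) : Prop := forall k, Ck k U f.

Record chart (M E : Type) := Chart {
  cdom : set M;
  cmap : M -> E;
  cinv : E -> M }.

(* An atlas is indexed by the points of M, the chart [A p] being one around p.
   This loses no generality (choose a chart of the maximal atlas around each
   point) and lets the model space E serve as the tangent space T_p M at every
   point p, a tangent vector being given by its coordinates in [A p]. *)
Definition atlas (M E : Type) := M -> chart M E.

Section Manifolds.
Variable R : realType.

Definition cimg (M : Type) (E : normedModType R) (c : chart M E) (U : set M) :
  set E := cmap c @` (cdom c `&` U).

Definition is_chart (M : topologicalType) (E : normedModType R)
    (c : chart M E) : Prop :=
  [/\ open (cdom c), open (cimg c setT),
      forall p, cdom c p -> cinv c (cmap c p) = p,
      forall p, cdom c p -> {for p, continuous (cmap c)}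
    & forall z, cimg c setT z -> {for z, continuous (cinv c)}].

Definition smooth_manifold (M : topologicalType) (E : normedModType R)
    (A : atlas M E) : Prop :=
  [/\ hausdorff_space M, @second_countable M,
      forall p, is_chart (A p) /\ cdom (A p) p
    & forall p q, smooth (cimg (A p) (cdom (A q)))
                         (fun z => cmap (A q) (cinv (A p) z))].

Definition smooth_map (M N : topologicalType) (E F : normedModType R)
    (A : atlas M E) (B : atlas N F) (f : M -> N) : Prop :=
  continuous f
  /\ forall p q, smooth (cimg (A p) (f @^-1` cdom (B q)))
                        (fun z => cmap (B q) (f (cinv (A p) z))).

(* The tangent map of f at p, from T_p M = E to T_(f p) N = F. *)
Definition tmap (M N : Type) (E F : normedModType R)
    (A : atlas M E) (B : atlas N F) (f : M -> N) (p : M) : E -> F :=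
  'd (fun z => cmap (B (f p)) (f (cinv (A p) z))) (cmap (A p) p).

Definition id_atlas (E : normedModType R) : atlas E E :=
  fun=> Chart setT id id.

Definition prod_atlas (M N : Type) (E F : normedModType R)
    (A : atlas M E) (B : atlas N F) : atlas (M * N) (E * F) :=
  fun p => Chart (cdom (A p.1) `*` cdom (B p.2))
                 (fun q => (cmap (A p.1) q.1, cmap (B p.2) q.2))
                 (fun z => (cinv (A p.1) z.1, cinv (B p.2) z.2)).

(* The velocity at t = 0, in T_p M, of a curve c with c 0 = p. *)
Definition velocity (M : Type) (E : normedModType R) (A : atlas M E) (p : M)
    (c : R -> M) : E :=
  derive1 (fun t => cmap (A p) (c t)) 0.

End Manifolds.

Section Symplectic.
Variables (R : realType) (n : nat) (M : topologicalType).
Variable A : atlas M 'rV[R]_n.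
Variable omega : M -> 'rV[R]_n -> 'rV[R]_n -> R.

Definition local_form (p : M) (z u v : 'rV[R]_n) : R :=
  let q := cinv (A p) z in
  let T := 'd (fun y => cmap (A q) (cinv (A p) y)) z in
  omega q (T u) (T v).

(* Closedness is the vanishing of d omega on the constant vector fields u, v, w
   of each chart; these commute, whence the cyclic sum. *)
Definition symplectic_form : Prop :=
  [/\ forall p a u u' v,
        omega p (a *: u + u') v = a * omega p u v + omega p u' v,
      forall p u v, omega p u v = - omega p v u,
      forall p u, (forall v, omega p u v = 0) -> u = 0,
      forall p u v, smooth (cimg (A p) setT) (fun z => local_form p z u v : R)
    & forall p z u v w, cimg (A p) setT z ->
        'd (fun y => local_form p y v w : R) z u
        + 'd (fun y => local_form p y w u : R) z v
        + 'd (fun y => local_form p y u v : R) z w = 0].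

Definition symp_orth (m : M) (W : set 'rV[R]_n) : set 'rV[R]_n :=
  [set v | forall w, W w -> omega m v w = 0].

Definition lagrangian_in (m : M) (V L : set 'rV[R]_n) : Prop :=
  L = V `&` symp_orth m L.

End Symplectic.

#[short(type="topGroupType")]
HB.structure Definition TopGroup := {G of Group G & Topological G}.

Section LieGroups.
Variables (R : realType) (d : nat) (G : topGroupType).
Variables (A : atlas G 'rV[R]_d) (exp : 'rV[R]_d -> G).

Definition lie_group : Prop :=
  [/\ smooth_manifold A,
      smooth_map (prod_atlas A A) A (fun p : G * G => (p.1 * p.2)%g)
    & smooth_map A A (fun g : G => (g^-1)%g)].

(* The Lie algebra is T_1 G = 'rV[R]_d; [exp] is determined by these
   conditions. *)
Definition is_exponential : Prop :=
  forall x : 'rV[R]_d,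
  [/\ smooth_map (@id_atlas R R) A (fun t : R => exp (t *: x)),
      forall s t : R, exp ((s + t) *: x) = (exp (s *: x) * exp (t *: x))%g
    & velocity A 1%g (fun t : R => exp (t *: x)) = x].

Definition Ad (g : G) : 'rV[R]_d -> 'rV[R]_d :=
  tmap A A (fun k : G => (g * k * g^-1)%g) 1%g.

(* [x, y] = d/dt|_(t = 0) Ad_(exp (t x)) y *)
Definition bracket (x y : 'rV[R]_d) : 'rV[R]_d :=
  derive1 (fun t : R => Ad (exp (t *: x)) y) 0.

(* The Lie algebra of a closed subgroup K. *)
Definition lie_algebra (K : set G) : set 'rV[R]_d :=
  [set x | forall t : R, K (exp (t *: x))].

(* Covectors are columns. *)
Definition pairing (l : 'cV[R]_d) (x : 'rV[R]_d) : R := (x *m l) 0 0.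

(* {x | ad*_x l = 0} *)
Definition isotropy_algebra (l : 'cV[R]_d) : set 'rV[R]_d :=
  [set x | forall y, pairing l (bracket x y) = 0].

End LieGroups.

Section LieSubgroups.
Variables (R : realType) (k d : nat) (H G : topGroupType).
Variables (AH : atlas H 'rV[R]_k) (AG : atlas G 'rV[R]_d) (iota : H -> G).

(* A (possibly only immersed) Lie subgroup of G is presented by its inclusion
   iota : H -> G; as a subset of G it is [range iota]. *)
Definition lie_subgroup : Prop :=
  [/\ smooth_map AH AG iota,
      forall h h' : H, iota (h * h')%g = (iota h * iota h')%g,
      injective iota
    & forall h : H, injective (tmap AH AG iota h)].

(* The inclusion of the Lie algebra of H into that of G. *)
Definition lie_incl : 'rV[R]_k -> 'rV[R]_d := tmap AH AG iota 1%g.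

(* Restriction of covectors to the Lie algebra of H. *)
Definition restrict_covector (l : 'cV[R]_d) : 'cV[R]_k := lin1_mx lie_incl *m l.

End LieSubgroups.

Section Sums.
Variables (R : realType) (V : lmodType R).

Definition sumset (A B : set V) : set V := [set x + y | x in A & y in B].

Definition dsum (A B C : set V) : Prop :=
  A `&` B = [set 0] /\ sumset A B = C.

Definition invariant_under (G : Type) (K : set G) (rho : G -> V -> V)
  (W : set V) : Prop := forall g v, K g -> W v -> W (rho g v).

(* W is a K-invariant complement of A in C *)
Definition inv_complement (G : Type) (K : set G) (rho : G -> V -> V)
  (A W C : set V) : Prop := dsum A W C /\ invariant_under K rho W.

End Sums.

Section Actions.
Variables (R : realType) (n d : nat) (M : topologicalType) (G : topGroupType).
Variables (AM : atlas M 'rV[R]_n) (AG : atlas G 'rV[R]_d).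
Variables (exp : 'rV[R]_d -> G) (act : G -> M -> M).

Definition smooth_action : Prop :=
  [/\ forall p, act 1%g p = p,
      forall g h p, act (g * h)%g p = act g (act h p)
    & smooth_map (prod_atlas AG AM) AM (fun p : G * M => act p.1 p.2)].

Definition proper_action : Prop :=
  forall K : set (M * M), compact K ->
    compact ((fun p : G * M => (act p.1 p.2, p.2)) @^-1` K).

Definition act_tangent (m : M) (g : G) : 'rV[R]_n -> 'rV[R]_n :=
  tmap AM AM (act g) m.

Definition preserves_form (omega : M -> 'rV[R]_n -> 'rV[R]_n -> R) : Prop :=
  forall g p u v,
    omega (act g p) (act_tangent p g u) (act_tangent p g v) = omega p u v.

Definition stabilizer (m : M) : set G := [set g | act g m = m].

(* x_M(p) = d/dt|_(t = 0) exp(t x) . p *)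
Definition inf_action (p : M) (x : 'rV[R]_d) : 'rV[R]_n :=
  velocity AM p (fun t : R => act (exp (t *: x)) p).

Definition momentum_map (omega : M -> 'rV[R]_n -> 'rV[R]_n -> R)
    (Phi : M -> 'cV[R]_d) : Prop :=
  [/\ smooth_map AM (@id_atlas R 'cV[R]_d) Phi,
      forall p x v, omega p (inf_action p x) v
        = tmap AM (@id_atlas R R) (fun q => pairing (Phi q) x) p v
    & forall g p x,
        pairing (Phi (act g p)) x = pairing (Phi p) (Ad AG (g^-1)%g x)].

Definition ker_tangent (Phi : M -> 'cV[R]_d) (m : M) : set 'rV[R]_n :=
  [set v | tmap AM (@id_atlas R 'cV[R]_d) Phi m v = 0].

(* N is an invariant complement of g_mu . m in ker (D Phi(m)), mu = Phi m; its
   symplectic form is the restriction of that of T_m M. *)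
Definition symplectic_slice (Phi : M -> 'cV[R]_d) (m : M)
    (N : {vspace 'rV[R]_n}) : Prop :=
  inv_complement (stabilizer m) (act_tangent m)
    (inf_action m @` isotropy_algebra AG exp (Phi m))
    [set` N] (ker_tangent Phi m).

End Actions.

(* Main.v *)
(* Everything rests on the identities [omega (x_M, v) = <D Phi v, x>] and
   [omega (x_M, y_M) = <mu, [x, y]>].  The first makes N1, which lies in
   ker (D Phi), orthogonal to g . m; the second makes b . m, with b inside g_mu,
   isotropic and orthogonal to s . m.  The space Y lies in N0, which is Lagrangian
   in the orthogonal of T1 + N1, so Y is isotropic and orthogonal to N1 and to
   s . m, which lies in T1.  Only the pairing of b . m with Y survives, and it
   is given by f.

   For the second identity, differentiate t |-> <Phi (exp (t x) . m), y> along
   the orbit and use equivariance.  The bracket being the derivative of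
   t |-> Ad (exp (t x)) y, one must know that this curve is differentiable:
   with nu the multiplication in the chart at 1, Ad_g y is
   D nu (g, g^-1) (D nu (g, 1) (0, y), 0), whose dependence on g along the
   one-parameter group is differentiable because nu is of class C^2. *)

From HB Require Import structures.
Require Import Defs.
From mathcomp Require Import all_boot all_order all_algebra.
From mathcomp Require Import all_classical all_reals all_analysis.
Import Order.TTheory GRing.Theory Num.Theory.
Import numFieldNormedType.Exports.
Local Open Scope classical_set_scope.
Local Open Scope ring_scope.

Set Implicit Arguments.
Unset Strict Implicit.
Unset Printing Implicit Defensive.

(** * Differentiation of germs and of smooth maps read in charts *)

(** A differential depends only on the germ: the first-order expansion of [f] at [x] carries over to
    [g], and it determines the linear part. Formulas in charts hold only near a point, and this is
    how they get differentiated. *)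
Lemma near_eq_is_diff (R : numFieldType) (V W : normedModType R)
    (f g : V -> W) (x : V) :
  {near x, f =1 g} -> differentiable f x -> is_diff x g ('d f x).
Proof.
move=> fg df.
have gx : g x = f x by rewrite (nbhs_singleton fg).
have go : g \o shift x = cst (g x) + 'd f x +o_ 0 id.
  apply/eqaddoP => e e0; have /eqaddoP/(_ e e0) := diff_locally df.
  have fg0 : \forall h \near 0, f (h + x) = g (h + x).
    by move: fg; rewrite (near_shift 0 x) subr0.
  by apply: filterS2 fg0 => h /= fgh; rewrite !fctE /= gx fgh.
have dg : 'd g x = 'd f x :> (V -> W).
  by apply: diff_unique => //; exact: diff_continuous.
by apply: DiffDef => //; apply/diff_locallyP; rewrite dg; split => //;
  exact: diff_continuous.
Qed.

Section smoothness.
Variables (R : realType) (E F : normedModType R) (U : set E) (f : E -> F).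
Hypothesis f_smooth : smooth U f.

Lemma smooth_differentiable z : U z -> differentiable f z.
Proof. exact: (f_smooth 1%N).1. Qed.

Lemma smooth_diff_differentiable z v :
  U z -> differentiable (fun y => 'd f y v) z.
Proof. exact: ((f_smooth 2%N).2 v).1. Qed.

End smoothness.

Lemma smooth_map_differentiable (R : realType) (M N : topologicalType)
    (E F : normedModType R) (A : atlas M E) (B : atlas N F)
    (f : M -> N) (p q : M) (r : N) :
  smooth_map A B f -> cdom (A p) q -> cdom (B r) (f q) ->
  differentiable (fun z => cmap (B r) (f (cinv (A p) z))) (cmap (A p) q).
Proof.
by move=> [_ fs] pq rfq; apply: smooth_differentiable (fs p r) _ _; exists q.
Qed.

(** * One-parameter subgroups, and the adjoint action in the chart at 1 *)

Section exponential.
Variables (R : realType) (d : nat) (G : topGroupType).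
Variables (A : atlas G 'rV[R]_d) (exp : 'rV[R]_d -> G).
Hypotheses (G_lie : lie_group A) (expP : is_exponential A exp).

Lemma exp0 : exp 0 = 1%g.
Proof.
have [_ + _] := expP 0 => /(_ 0 0); rewrite addr0 scale0r => e.
by apply: (@mulgI _ (exp 0)); rewrite mulg1 -e.
Qed.

Lemma exp_opp x : exp (- x) = ((exp x)^-1)%g.
Proof.
have [_ + _] := expP x => /(_ 1 (-1)); rewrite subrr scale0r exp0 scale1r scaleN1r.
by move=> e; apply: (@mulgI _ (exp x)); rewrite mulgV -e.
Qed.

Lemma atlas_chart p : is_chart (A p).
Proof. by have [[_ _ /(_ p)[]]] := G_lie. Qed.

Lemma atlas_cdom p : cdom (A p) p.
Proof. by have [[_ _ /(_ p)[]]] := G_lie. Qed.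

Lemma exp_continuous x : continuous (fun t : R => exp (t *: x)).
Proof. by have [[]] := expP x. Qed.

Lemma near_exp_cdom x : \forall t \near (0 : R), cdom (A 1%g) (exp (t *: x)).
Proof.
have [odom _ _ _ _] := atlas_chart 1%g.
apply: exp_continuous; rewrite scale0r exp0.
by apply: open_nbhs_nbhs; split => //; exact: atlas_cdom.
Qed.

Lemma chart_exp_differentiable x (t : R) : cdom (A 1%g) (exp (t *: x)) ->
  differentiable (fun s : R => cmap (A 1%g) (exp (s *: x))) t.
Proof.
have [es _ _] := expP x => tx.
exact: (@smooth_map_differentiable _ _ _ _ _ _ _ _ t t 1%g es).
Qed.

(** The map nu: it represents the product faithfully only where both factors and the product lie in
    the chart domain at 1. *)
Definition chart_mul (z : 'rV[R]_d * 'rV[R]_d) : 'rV[R]_d :=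
  cmap (A 1%g) (cinv (A 1%g) z.1 * cinv (A 1%g) z.2)%g.

Lemma chart_mulE g h : cdom (A 1%g) g -> cdom (A 1%g) h ->
  chart_mul (cmap (A 1%g) g, cmap (A 1%g) h) = cmap (A 1%g) (g * h)%g.
Proof.
by have [_ _ K _ _] := atlas_chart 1%g => gd hd; rewrite /chart_mul /= !K.
Qed.

Section chart_mul_differentiable.
Variables g h : G.
Hypotheses (gP : cdom (A 1%g) g) (hP : cdom (A 1%g) h).
Hypothesis ghP : cdom (A 1%g) (g * h)%g.

Lemma chart_mul_differentiable :
  differentiable chart_mul (cmap (A 1%g) g, cmap (A 1%g) h).
Proof.
have [_ [_ /(_ (1, 1)%g 1%g) ms] _] := G_lie.
by apply: smooth_differentiable ms _ _; exists (g, h).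
Qed.

(** The one place where second-order smoothness of the multiplication enters. *)
Lemma diff_chart_mul_differentiable v :
  differentiable (fun z => 'd chart_mul z v) (cmap (A 1%g) g, cmap (A 1%g) h).
Proof.
have [_ [_ /(_ (1, 1)%g 1%g) ms] _] := G_lie.
by apply: smooth_diff_differentiable ms _ _ _; exists (g, h).
Qed.

End chart_mul_differentiable.

(** Conjugation is left multiplication by [g] followed by right multiplication by its inverse. The
    chain rule applies to these two maps in the chart at 1, the intermediate base point being g * 1
    = g. *)
Lemma Ad_chart g y : cdom (A 1%g) g -> cdom (A 1%g) (g^-1)%g ->
  Ad A g y =
    'd chart_mul (cmap (A 1%g) g, cmap (A 1%g) (g^-1)%g)
      ('d chart_mul (cmap (A 1%g) g, cmap (A 1%g) 1%g) (0, y), 0).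
Proof.
move=> gP gVP; rewrite /Ad /tmap mulg1 mulgV.
set e := cmap (A 1%g) 1%g.
have [odom _ K _ cK] := atlas_chart 1%g.
have d1 := atlas_cdom 1%g.
pose F z := chart_mul (chart_mul (cmap (A 1%g) g, z), cmap (A 1%g) (g^-1)%g).
have mulge : chart_mul (cmap (A 1%g) g, e) = cmap (A 1%g) g.
  by rewrite chart_mulE // mulg1.
have dl : is_diff e (fun z => (cmap (A 1%g) g, z)) (fun v => (0, v)).
  exact: is_diff_pair.
have dm : is_diff (cmap (A 1%g) g, e) chart_mul
            ('d chart_mul (cmap (A 1%g) g, e)).
  by apply: differentiableP; apply: chart_mul_differentiable; rewrite ?mulg1.
have dm' : is_diff (cmap (A 1%g) g, cmap (A 1%g) (g^-1)%g) chart_mul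
            ('d chart_mul (cmap (A 1%g) g, cmap (A 1%g) (g^-1)%g)).
  by apply: differentiableP; apply: chart_mul_differentiable; rewrite ?mulgV.
have dml := is_diff_comp dl dm.
have dr : is_diff e
    (fun z => (chart_mul (cmap (A 1%g) g, z), cmap (A 1%g) (g^-1)%g))
    (fun v => ('d chart_mul (cmap (A 1%g) g, e) (0, v), 0)).
  exact: is_diff_pair dml (is_diff_cst _ _).
have dF : is_diff e F (fun v => 'd chart_mul (cmap (A 1%g) g, cmap (A 1%g) (g^-1)%g)
      ('d chart_mul (cmap (A 1%g) g, e) (0, v), 0)).
  have dm'' : is_diff ((fun z => (chart_mul (cmap (A 1%g) g, z),
      cmap (A 1%g) (g^-1)%g)) e) chart_mul
      ('d chart_mul (cmap (A 1%g) g, cmap (A 1%g) (g^-1)%g)).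
    by rewrite mulge.
  exact: is_diff_comp dr dm''.
(* [F] returns to the group after the first multiplication, so the two maps agree only while g * k
   stays in the chart domain; this holds for k near 1 because the domain is open and contains
   [g]. *)
have eF : {near e, F =1
    fun z => cmap (A 1%g) (g * cinv (A 1%g) z * g^-1)%g}.
  have cm : {for e, continuous (fun z => g * cinv (A 1%g) z)%g}.
    have [_ [cmul _] _] := G_lie.
    have ce : {for e, continuous (cinv (A 1%g))} by apply: cK; exists 1%g.
    apply: (@continuous_comp _ _ _ (fun z => (g, cinv (A 1%g) z))
              (fun p : G * G => (p.1 * p.2)%g)); last exact: cmul.
    exact: (@cvg_pair _ _ _ (nbhs e) (nbhs g) _ _ _ _ (cst g) _ (cvg_cst g) ce).
  have gdom : nbhs (g * cinv (A 1%g) e)%g (cdom (A 1%g)).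
    by rewrite K // mulg1; exact: open_nbhs_nbhs.
  apply: (@filterS _ (nbhs e) _ _ _ _ (cm _ gdom)) => z /= zP.
  by rewrite /F /chart_mul /= (K g) // !K.
case: dF => dF dFE.
by have [_ ->] := near_eq_is_diff eF dF; rewrite dFE.
Qed.

(** [bracket] is a [derive1], a term that makes sense even where no derivative exists; this shows
    that it is a genuine derivative. *)
Lemma Ad_exp_derivable x y :
  derivable (fun t : R => Ad A (exp (t *: x)) y) 0 1.
Proof.
set e := cmap (A 1%g) 1%g.
have d1 := atlas_cdom 1%g.
pose c (t : R) := cmap (A 1%g) (exp (t *: x)).
pose u (t : R) := 'd chart_mul (c t, e) (0, y).
pose w (t : R) v := 'd chart_mul (c t, c (- t)) (v, 0).
(* For small t both exp (t x) and its inverse exp (- t x) lie in the chart at 1, with coordinates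
   [c t] and [c (- t)]. *)
have E : {near 0, (fun t => w t (u t)) =1 (fun t => Ad A (exp (t *: x)) y)}.
  have := near_exp_cdom (- x); have := near_exp_cdom x.
  apply: filterS2 => t tP; rewrite scalerN exp_opp => tNP.
  rewrite (Ad_chart _ tP tNP).
  rewrite /w /u /c.
  rewrite [- t *: x]scaleNr.
  by rewrite exp_opp.
apply: near_eq_derivable E _.
have c0 : c 0 = e by rewrite /c scale0r exp0.
have dc : differentiable c 0.
  by apply: chart_exp_differentiable; rewrite scale0r exp0.
have dcN : differentiable (fun t => c (- t)) 0.
  apply: (@differentiable_comp _ _ _ _ (fun t : R => - t) c) => //.
  by rewrite oppr0.
have du : differentiable u 0.
  apply: (@differentiable_comp _ _ _ _ (fun t : R => (c t, e))
            (fun z => 'd chart_mul z (0, y))).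
    exact: differentiable_pair.
  by rewrite c0; apply: diff_chart_mul_differentiable; rewrite ?mulg1.
have dw v : differentiable (w^~ v) 0.
  apply: (@differentiable_comp _ _ _ _ (fun t : R => (c t, c (- t)))
            (fun z => 'd chart_mul z (v, 0))).
    exact: differentiable_pair.
  by rewrite oppr0 c0; apply: diff_chart_mul_differentiable; rewrite ?mulg1.
(* The linear map [w t] and its argument [u t] both vary with t. Expanding [u t] in the standard
   basis leaves, entry by entry, a sum of products of differentiable scalar functions. *)
have wE t : w t (u t) = \sum_(i < d) u t 0 i *: w t 'e_i.
  rewrite {1}/w [in LHS](row_sum_delta (u t)).
  have -> : (\sum_(j < d) u t 0 j *: 'e_j, 0) =
      \sum_(j < d) u t 0 j *: ('e_j, 0) :> 'rV[R]_d * 'rV[R]_d.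
    apply: (big_rec2 (fun a (b : 'rV[R]_d * 'rV[R]_d) => (a, 0) = b)) => //.
    by move=> l a b _ <-; congr pair; rewrite /= scaler0 addr0.
  by rewrite linear_sum; apply: eq_bigr => i _; rewrite linearZ.
apply/derivable_mxP => i j.
have -> : (fun t => w t (u t) i j) =
    \sum_(l < d) ((fun t => u t 0 l) * (fun t => w t 'e_l i j)).
  apply/funext => t; rewrite wE summxE fct_sumE.
  by apply: eq_bigr => l _; rewrite !mxE.
apply: derivable_sum => l; apply: derivableM.
  by move/derivable1_diffP/derivable_mxP : du; exact.
by move/derivable1_diffP/derivable_mxP : (dw 'e_l); exact.
Qed.

End exponential.

(** * The pairing of covectors and vectors as a differentiable map *)

Section pairing.
Variables (R : realType) (d : nat).
Implicit Types (l : 'cV[R]_d) (x : 'rV[R]_d).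

Lemma pairingE l x : pairing l x = \sum_(j < d) x 0 j * l j 0.
Proof. by rewrite /pairing mxE. Qed.

(** A continuous linear map is its own differential; continuity comes from writing the map as a
    combination of coordinates. *)
Lemma is_diff_pairing_vector l x : is_diff x (pairing l : _ -> R) (pairing l).
Proof.
have lin : linear (pairing l : 'rV[R]_d -> R).
  by move=> a u v; rewrite /pairing mulmxDl -scalemxAl !mxE.
pose linM := GRing.isLinear.Build _ _ _ _ _ lin.
pose f : {linear 'rV[R]_d -> R} := HB.pack (pairing l : 'rV[R]_d -> R) linM.
have fc : continuous f.
  move=> u; apply: differentiable_continuous.
  have -> : f = \sum_(j < d) (l j 0 *: (fun v : 'rV[R]_d => v 0 j : R)) :> (_ -> _).
    apply/funext => v; rewrite /= pairingE fct_sumE.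
    by apply: eq_bigr => j _; rewrite mulrC.
  apply: differentiable_sum => j; apply: differentiableZ.
  exact: differentiable_coord.
apply: DiffDef; first exact: (linear_differentiable (f := f)).
exact: (diff_lin (f := f)).
Qed.

Lemma is_diff_pairing_covector x l :
  is_diff l ((@pairing R d)^~ x : _ -> R) ((@pairing R d)^~ x).
Proof.
have lin : linear ((@pairing R d)^~ x : 'cV[R]_d -> R).
  by move=> a u v; rewrite /pairing mulmxDr -scalemxAr !mxE.
pose linM := GRing.isLinear.Build _ _ _ _ _ lin.
pose f : {linear 'cV[R]_d -> R} := HB.pack ((@pairing R d)^~ x : 'cV[R]_d -> R) linM.
have fc : continuous f.
  move=> u; apply: differentiable_continuous.
  have -> : f = \sum_(j < d) (x 0 j *: (fun v : 'cV[R]_d => v j 0 : R)) :> (_ -> _).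
    by apply/funext => v; rewrite /= pairingE fct_sumE.
  apply: differentiable_sum => j; apply: differentiableZ.
  exact: differentiable_coord.
apply: DiffDef; first exact: (linear_differentiable (f := f)).
exact: (diff_lin (f := f)).
Qed.

Lemma pairing0 x : pairing 0 x = 0.
Proof. by rewrite /pairing mulmx0 mxE. Qed.

End pairing.

(** * The two momentum identities for the symplectic form *)

Section momentum.
Variables (R : realType) (n d : nat) (M : topologicalType).
Variables (AM : atlas M 'rV[R]_n) (omega : M -> 'rV[R]_n -> 'rV[R]_n -> R).
Variables (G : topGroupType) (AG : atlas G 'rV[R]_d) (exp : 'rV[R]_d -> G).
Variables (act : G -> M -> M) (Phi : M -> 'cV[R]_d).
Hypotheses (M_manifold : smooth_manifold AM).
Hypotheses (omega_symplectic : symplectic_form AM omega).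
Hypotheses (G_lie : lie_group AG) (expP : is_exponential AG exp).
Hypotheses (act_smooth : smooth_action AM AG act).
Hypothesis Phi_momentum : momentum_map AM AG exp act omega Phi.

Local Notation xM := (inf_action AM exp act).

Lemma momentum_chart_differentiable p :
  differentiable (fun z => Phi (cinv (AM p) z)) (cmap (AM p) p).
Proof.
have [Phi_smooth _ _] := Phi_momentum; have [_ _ /(_ p)[_ pp] _] := M_manifold.
(* The target carries a single global chart, so the index 0 is arbitrary. *)
exact: (smooth_map_differentiable (r := 0) Phi_smooth pp).
Qed.

(** The momentum condition differentiates q |-> <Phi q, x>; as the pairing is linear in the
    covector, the chain rule moves it outside D Phi. *)
Lemma momentum_form p x v :
  omega p (xM p x) v = pairing (tmap AM (@id_atlas R 'cV[R]_d) Phi p v) x.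
Proof.
have [_ -> _] := Phi_momentum; rewrite /tmap /=.
have dPhi := differentiableP (momentum_chart_differentiable p).
set l := Phi (cinv (AM p) (cmap (AM p) p)).
by have [_ ->] := is_diff_comp dPhi (is_diff_pairing_covector x l).
Qed.

(** The orbit curve is constant. This places 0 in the image of a subspace under [inf_action] without
    appeal to linearity of x |-> x_M. *)
Lemma inf_action0 p : xM p 0 = 0.
Proof.
rewrite /inf_action /velocity.
under eq_fun do rewrite scaler0.
exact: derive1_cst.
Qed.

Lemma form_linearl p v : linear (omega p ^~ v : _ -> R).
Proof. by move=> a u u'; have [-> _ _ _ _] := omega_symplectic. Qed.

Lemma formC p u v : omega p u v = - omega p v u.
Proof. by have [_ + _ _ _] := omega_symplectic; exact. Qed.

Lemma formDl p u u' v : omega p (u + u') v = omega p u v + omega p u' v.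
Proof. by have := form_linearl p v 1 u u'; rewrite !scale1r. Qed.

Lemma formDr p u v v' : omega p u (v + v') = omega p u v + omega p u v'.
Proof. by rewrite formC formDl opprD -!formC. Qed.

Section orbit_curve.
Variables (p : M) (x : 'rV[R]_d).
Let c (t : R) := cmap (AM p) (act (exp (t *: x)) p).

Lemma orbit_curve_continuous : continuous (fun t : R => act (exp (t *: x)) p).
Proof.
have [_ _ [act_cont _]] := act_smooth => t.
apply: (@continuous_comp _ _ _ (fun t : R => (exp (t *: x), p))
          (fun q : G * M => act q.1 q.2)); last exact: act_cont.
have ct := @exp_continuous _ _ _ _ _ expP x t.
exact: (@cvg_pair _ _ _ (nbhs t) (nbhs (exp (t *: x))) (nbhs p) _ _ _ _
  (cst p) ct (cvg_cst p)).
Qed.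

Lemma near_orbit_cdom :
  \forall t \near (0 : R), cdom (AM p) (act (exp (t *: x)) p).
Proof.
have [_ _ /(_ p)[[odom _ _ _ _] pp] _] := M_manifold.
have [act1 _ _] := act_smooth.
apply: orbit_curve_continuous; rewrite scale0r (exp0 expP) act1.
exact: open_nbhs_nbhs.
Qed.

(** Near t = 0 the curve is the action read in charts, composed with t |-> (exp (t x), p); the
    formula is valid while exp (t x) stays in the chart at 1. *)
Lemma chart_orbit_differentiable : differentiable c 0.
Proof.
have [act1 _ act_s] := act_smooth.
have [_ _ /(_ p)[_ pp] _] := M_manifold.
have d1 := atlas_cdom G_lie 1%g.
have [_ _ K _ _] := atlas_chart G_lie 1%g.
have [_ _ /(_ p)[[_ _ KM _ _] _] _] := M_manifold.
pose F z := cmap (AM p) (act (cinv (AG 1%g) z.1) (cinv (AM p) z.2)).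
have dF : differentiable F (cmap (AG 1%g) 1%g, cmap (AM p) p).
  apply: (@smooth_map_differentiable _ _ _ _ _ (prod_atlas AG AM) AM _ (1%g, p)
           (1%g, p) p act_s) => //=.
  by rewrite act1.
have dG : differentiable (fun t : R => cmap (AG 1%g) (exp (t *: x))) 0.
  by apply: chart_exp_differentiable => //; rewrite scale0r (exp0 expP).
pose P (t : R) := (cmap (AG 1%g) (exp (t *: x)), cmap (AM p) p).
have dP : differentiable P 0 by exact: differentiable_pair.
have dFP : differentiable (F \o P) 0.
  by apply: differentiable_comp => //; rewrite /P scale0r (exp0 expP).
have E : {near 0, F \o P =1 c}.
  have := near_exp_cdom G_lie expP x; apply: filterS => t tP.
  by rewrite /F /P /c /= K // KM.
by have [] := near_eq_is_diff E dFP.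
Qed.

End orbit_curve.

(** Two signs cancel: one from antisymmetry, which makes y_M the vector contracted with the form,
    and one from equivariance, which involves Ad of exp (t x)^-1 = exp (- t x) and so reverses
    time. *)
Lemma form_inf_action p x y :
  omega p (xM p x) (xM p y) = pairing (Phi p) (bracket AG exp x y).
Proof.
have [_ Phi_form Phi_equiv] := Phi_momentum.
have [act1 _ _] := act_smooth.
have [_ _ /(_ p)[[_ _ K _ _] pp] _] := M_manifold.
rewrite formC Phi_form /tmap /=.
pose c (t : R) := cmap (AM p) (act (exp (t *: x)) p).
pose F z := pairing (Phi (cinv (AM p) z)) y.
have c0 : c 0 = cmap (AM p) p by rewrite /c scale0r (exp0 expP) act1.
have dc : differentiable c 0 := chart_orbit_differentiable p x.
have dF : differentiable F (c 0).
  rewrite c0; apply: (@differentiable_comp _ _ _ _ _ ((@pairing R d)^~ y)).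
    exact: momentum_chart_differentiable.
  by have [] := is_diff_pairing_covector y (Phi (cinv (AM p) (cmap (AM p) p))).
(* By definition x_M is the velocity of [c], so the differential of <Phi, y> along x_M is the
   derivative of [F \o c] at 0. *)
rewrite -[xM p x]/(derive1 c 0) derive1E' // -c0.
have -> : 'd F (c 0) ('d c 0 1) = 'd (F \o c) 0 1 by rewrite diff_comp.
rewrite -derive1E'; last exact: differentiable_comp.
pose g (t : R) := pairing (Phi p) (Ad AG (exp (t *: x)) y).
have dAd := @Ad_exp_derivable _ _ _ _ _ G_lie expP x y.
have [dg gE] : is_diff (0 : R) g
    (pairing (Phi p) \o 'd (fun t : R => Ad AG (exp (t *: x)) y) 0).
  apply: (is_diff_comp (f := fun t : R => Ad AG (exp (t *: x)) y)) => //.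
    by apply: differentiableP; apply/derivable1_diffP.
  exact: is_diff_pairing_vector.
(* Equivariance along the orbit, valid while the orbit stays in the chart at p, where [cinv]
   recovers the point. *)
have E : {near 0, F \o c =1 g \o -%R}.
  apply: filterS (near_orbit_cdom p x) => t tP.
  rewrite /F /c /= (K _ tP) Phi_equiv /g.
  by rewrite [- t *: x]scaleNr (exp_opp expP).
rewrite derive1E (near_eq_derive _ E) -derive1E derive1_comp.
- have -> : (-%R : R -> R)^`()%classic 0 = -1 by rewrite derive1E derive_val.
  rewrite mulrN1 opprK oppr0.
  rewrite derive1E' // gE /= /bracket derive1E' //.
  exact/derivable1_diffP.
- exact: derivable_opp.
- by rewrite oppr0; exact/derivable1_diffP.
Qed.

End momentum.

(** * Orthogonality of the summands of the slice *)

(** The summands are arbitrary sets, so 0 in A has to be read off from the trivial intersection. *)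
Lemma dsum_subr (R : realType) (V : lmodType R) (A B C : set V) :
  dsum A B C -> B `<=` C.
Proof.
move=> [AB <-] v Bv; exists 0; last by exists v; rewrite ?add0r.
by have [] : (A `&` B) 0 by rewrite AB.
Qed.

Theorem theorem4p5 (R : realType) (n d k : nat)
  (M : topologicalType) (AM : atlas M 'rV[R]_n)
  (omega : M -> 'rV[R]_n -> 'rV[R]_n -> R)
  (G : topGroupType) (AG : atlas G 'rV[R]_d) (expG : 'rV[R]_d -> G)
  (H : topGroupType) (AH : atlas H 'rV[R]_k) (expH : 'rV[R]_k -> H)
  (iota : H -> G) (act : G -> M -> M) (Phi : M -> 'cV[R]_d) (m : M)
  (M_manifold : smooth_manifold AM) (omega_symplectic : symplectic_form AM omega)
  (G_lie : lie_group AG) (expGP : is_exponential AG expG)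
  (H_lie : lie_group AH) (expHP : is_exponential AH expH)
  (H_sub : lie_subgroup AH AG iota)
  (act_smooth : smooth_action AM AG act) (act_proper : proper_action act)
  (act_symplectic : preserves_form AM act omega)
  (Phi_momentum : momentum_map AM AG expG act omega Phi)
  (Gm_acts_on_H : forall g : G, stabilizer act m g ->
     [set (g * h * g^-1)%g | h in range iota] = range iota) :
  let mu := Phi m in
  let PhiH := fun r => restrict_covector AH AG iota (Phi r) in
  let alpha := PhiH m in
  let actH := fun h => act (iota h) in
  let Gm := stabilizer act m in
  let AdG := Ad AG in
  let xM := inf_action AM expG act m in
  let h := range (lie_incl AH AG iota) in
  let g_m := lie_algebra expG Gm in
  let h_m := lie_incl AH AG iota @` lie_algebra expH (stabilizer actH m) in
  let g_mu := isotropy_algebra AG expG mu in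
  let h_mu := h `&` g_mu in
  let h_alpha := lie_incl AH AG iota @` isotropy_algebra AH expH alpha in
  let h_perp := xM @^-1` symp_orth omega m (xM @` h) in
  forall
    (h_m_perp p b a s c : {vspace 'rV[R]_d})
    (h_m_perpP : inv_complement Gm AdG h_m [set` h_m_perp] g_m)
    (pP : inv_complement Gm AdG h_m [set` p] h_mu)
    (bP : inv_complement Gm AdG (sumset g_m h_mu) [set` b] g_mu)
    (aP : inv_complement Gm AdG h_mu [set` a] h_alpha)
    (sP : inv_complement Gm AdG (sumset g_mu h_alpha) [set` s] h_perp)
    (cP : inv_complement Gm AdG h_perp [set` c] setT),
  let mm := (p + b)%VS in
  let q := (a + s)%VS in
  let nn := (q + c)%VS in
  let T0 := xM @` g_mu in
  let T1 := xM @` [set` nn] in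
  forall
    (N1 N0 : {vspace 'rV[R]_n})
    (N1P : inv_complement Gm (act_tangent AM act m) T0 [set` N1]
             (ker_tangent AM Phi m)),
  let V0 := symp_orth omega m (sumset T1 [set` N1]) in
  forall
    (N0P : inv_complement Gm (act_tangent AM act m) T0 [set` N0] V0)
    (N0_lagrangian : lagrangian_in omega m V0 [set` N0]),
  forall (f : {linear subvs_of N0 -> 'Hom(subvs_of mm, R^o)})
    (fP : forall (w : subvs_of N0) (y : subvs_of mm),
       f w y = omega m (xM (vsval y)) (vsval w))
    (Y X N' : {vspace 'rV[R]_n})
    (Y_sub : (Y <= N0)%VS)
    (Y_iso : exists phi : {linear subvs_of Y -> 'Hom(subvs_of b, R^o)},
       bijective phi)
    (XP : dsum (xM @` [set` b]) [set` Y] [set` X])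
    (N'P : exists2 Z : set 'rV[R]_n,
       dsum (xM @` [set` s]) [set` X] Z & dsum Z [set` N1] [set` N'])
    (N'_slice : symplectic_slice AM AH expH actH PhiH m N'),
  [/\ (forall x x', x \in s -> x' \in s ->
         omega m (xM x) (xM x') = pairing mu (bracket AG expG x x')),
      (forall x x' u u' v v',
         x \in s -> x' \in s -> u \in X -> u' \in X -> v \in N1 -> v' \in N1 ->
         omega m (xM x + u + v) (xM x' + u' + v')
         = omega m (xM x) (xM x') + omega m u u' + omega m v v')
    & (forall b1 b2 w w',
         b1 \in b -> b2 \in b -> w \in Y -> w' \in Y ->
         omega m (xM b1 + w) (xM b2 + w') 
         = f (vsproj N0 w') (vsproj mm b1) - f (vsproj N0 w) (vsproj mm b2))].
Proof.
move=> mu PhiH alpha actH Gm AdG xM h g_m h_m g_mu h_mu h_alpha h_perp.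
move=> h_m_perp p b a s c _ _ [bP _] _ _ _ mm q nn T0 T1 N1 N0 [N1P _] V0 _.
move=> N0_lagrangian f fP Y X N' Y_sub _ XP _ _.
have N1_ker v : v \in N1 -> forall x, omega m (xM x) v = 0.
  move=> /(dsum_subr N1P) v_ker x.
  by rewrite (momentum_form M_manifold Phi_momentum) v_ker pairing0.
have xM0 : xM 0 = 0 by exact: inf_action0.
have formD := (formDl omega_symplectic, formDr omega_symplectic).
have formC := formC omega_symplectic m.
have form_xM x y : omega m (xM x) (xM y) = pairing mu (bracket AG expG x y).
  exact: (form_inf_action M_manifold omega_symplectic G_lie expGP act_smooth
    Phi_momentum).
(* The single equation N0 = V0 [&] N0^omega gives membership in V0 here and isotropy of Y next. *)
have Y_V0 w : w \in Y -> V0 w.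
  by move=> /(subvP Y_sub) w0; have [] : (V0 `&` symp_orth omega m [set` N0]) w;
    rewrite -?N0_lagrangian.
have Y_lagr w w' : w \in Y -> w' \in Y -> omega m w w' = 0.
  move=> /(subvP Y_sub) w0 /(subvP Y_sub) w0'.
  have [_ +] : (V0 `&` symp_orth omega m [set` N0]) w by rewrite -N0_lagrangian.
  exact.
(* V0 is orthogonal to T1 + N1; v enters this sum as 0_M + v. *)
have Y_N1 w v : w \in Y -> v \in N1 -> omega m w v = 0.
  move=> /Y_V0 + vN; apply; exists 0; last by exists v; rewrite ?add0r.
  by exists 0 => //; exact: mem0v.
(* The inclusions s <= q <= nn put x_M in T1. *)
have Y_s x w : x \in s -> w \in Y -> omega m (xM x) w = 0.
  move=> xs /Y_V0 w0; rewrite formC w0 ?oppr0 //.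
  exists (xM x); last by exists 0; [exact: mem0v|rewrite addr0].
  exists x => //=; apply: subvP xs.
  by apply: subv_trans (addvSl _ _); exact: addvSr.
(* Since b lies in g_mu, the value <mu, [x, y]> vanishes for every y, so b . m is orthogonal to all
   of g . m. *)
have b_xM x y : x \in b -> omega m (xM x) (xM y) = 0.
  by move=> /(dsum_subr bP) x_mu; rewrite form_xM; exact: x_mu.
have X_split u : u \in X -> exists2 y, y \in b & exists2 w, w \in Y & u = xM y + w.
  move=> uX; have [_] := XP => /seteqP[_ /(_ _ uX)] [_ [y yb <-]] [w wY <-].
  by exists y => //; exists w.
have X_N1 u v : u \in X -> v \in N1 -> omega m u v = 0.
  by move=> /X_split[y yb [w wY ->]] vN; rewrite formD N1_ker // Y_N1 // addr0.
have s_X x u : x \in s -> u \in X -> omega m (xM x) u = 0.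
  by move=> xs /X_split[y yb [w wY ->]]; rewrite formD formC b_xM // Y_s // oppr0 addr0.
split=> [x x' _ _|x x' u u' v v' xs xs' uX uX' vN vN'|b1 b2 w w' b1P b2P wP wP'].
- exact: form_xM.
(* Of the nine terms the six mixed ones vanish; three of them need antisymmetry to match the
   orthogonality facts. *)
- rewrite !formD (s_X x u') // (N1_ker v') // (X_N1 u v') //.
  rewrite (formC u (xM x')) (s_X x' u xs' uX) (formC v (xM x')) (N1_ker v vN).
  rewrite (formC v u') (X_N1 u' v uX' vN).
  by rewrite oppr0 !addr0 !add0r.
(* The b-b and Y-Y terms vanish. Antisymmetry turns omega (w, b2_M) into - f w b2, and the
   projections are harmless because Y <= N0 and b <= mm. *)
- rewrite !formD (b_xM b1) // (Y_lagr w w') // (formC w) !fP !vsprojK ?addr0 ?add0r //.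
  all: by [apply: (subvP Y_sub) | apply: subvP b1P; exact: addvSr
          | apply: subvP b2P; exact: addvSr].
Qed.
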